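(* Let $n\geq 2$ and $i\ge 1$ be integers and $F$ any field. Let $y_n\in K^M_*(F)/2$ be in the kernel of $\tau_i:K^M_*(F)/2\to K^M_*(F)/2$, $x\mapsto\{-1\}^{i-1}\cdot x$. Then, for symbols $s_1,\ldots,s_l$ in $K^M_i(F)/2$, the formula $$(y_n\cdot\gamma_n)(s_1+\cdots+s_l)=y_n\cdot\sum_{1\leq l_1<\cdots<l_n\leq l}s_{l_1}\cdot\ldots\cdot s_{l_n}$$ gives a well-defined map $K^M_i(F)/2\to K^M_*(F)/2$ (i.e. the right-hand side depends only on the element $s_1+\cdots+s_l$ of $K^M_i(F)/2$).
   Context: $K^M_*(F)=\bigoplus_{n\ge0}K^M_n(F)$ is the Milnor $K$-ring of $F$: the tensor algebra of the abelian group $F^\times$ modulo the ideal generated by the $a\otimes(1-a)$, $a\neq0,1$. The class of $a_1\otimes\cdots\otimes a_i$ is the symbol $\{a_1,\ldots,a_i\}\in K^M_i(F)$; $K^M_i(F)/2$ is the quotient by $2$. *)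

(* Defs.v *)
From HB Require Import structures.
From mathcomp Require Import all_boot all_order all_algebra.
From mathcomp Require Import generic_quotient ring_quotient.
From mathcomp Require Import boolp.
From mathcomp Require Import monalg.

Set Implicit Arguments.
Unset Strict Implicit.
Unset Printing Implicit Defensive.

Import GRing.Theory.
Local Open Scope ring_scope.
Local Open Scope quotient_scope.

Inductive ideal_gen (R : pzRingType) (S : R -> Prop) : R -> Prop :=
| ideal_gen_in x : S x -> ideal_gen S x
| ideal_gen0 : ideal_gen S 0
| ideal_genB x y : ideal_gen S x -> ideal_gen S y -> ideal_gen S (x - y)
| ideal_genMl a x : ideal_gen S x -> ideal_gen S (a * x)
| ideal_genMr a x : ideal_gen S x -> ideal_gen S (x * a).

Inductive subgroup_gen (V : zmodType) (S : V -> Prop) : V -> Prop :=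
| subgroup_gen_in x : S x -> subgroup_gen S x
| subgroup_gen0 : subgroup_gen S 0
| subgroup_genB x y :
    subgroup_gen S x -> subgroup_gen S y -> subgroup_gen S (x - y).

Section RingQuot.
Variables (R : pzRingType) (S : R -> Prop).

Definition ideal_pred : R -> bool := fun x => `[< ideal_gen S x >].

Lemma ideal_pred_zmod : zmod_closed ideal_pred.
Proof.
split=> [|x y /asboolP Ix /asboolP Iy]; apply/asboolP.
  exact: ideal_gen0.
exact: ideal_genB.
Qed.

HB.instance Definition _ := GRing.isZmodClosed.Build R ideal_pred
  ideal_pred_zmod.
Definition ideal_closed : zmodClosed R :=
  GRing.ZmodClosed.clone R ideal_pred _.

(* The library's ring structure on quotients only covers commutative rings. *)
Definition ring_quot : Type := Quotient.quot ideal_closed.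
HB.instance Definition _ := GRing.Zmodule.on ring_quot.

Definition rpi (x : R) : ring_quot := \pi_(Quotient.quot ideal_closed) x.

Lemma rpi_eq x y : rpi x = rpi y <-> ideal_gen S (x - y).
Proof.
split.
  by move/eqP; rewrite /rpi -Quotient.idealrBE => /asboolP.
by move=> h; apply/eqP; rewrite /rpi -Quotient.idealrBE; apply/asboolP.
Qed.

Definition rrepr (u : ring_quot) : R := repr (u : Quotient.quot ideal_closed).

Lemma rreprK u : rpi (rrepr u) = u. Proof. exact: reprK. Qed.

Lemma rpiB : {morph rpi : x y / x - y}.
Proof. by move=> x y; rewrite /rpi raddfB. Qed.

Lemma rpiD : {morph rpi : x y / x + y}.
Proof. by move=> x y; rewrite /rpi raddfD. Qed.

Definition rmul (u v : ring_quot) : ring_quot := rpi (rrepr u * rrepr v).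

Lemma rpiM x y : rpi (x * y) = rmul (rpi x) (rpi y).
Proof.
apply/rpi_eq; set x' := rrepr _; set y' := rrepr _.
have Ix : ideal_gen S (x - x') by apply/rpi_eq; rewrite rreprK.
have Iy : ideal_gen S (y' - y) by apply/rpi_eq; rewrite rreprK.
have -> : x * y - x' * y' = (x - x') * y - x' * (y' - y).
  by rewrite mulrBl mulrBr opprB addrA subrK.
by apply: ideal_genB; [apply: ideal_genMr | apply: ideal_genMl].
Qed.

Let rpiP (u : ring_quot) : exists x, u = rpi x.
Proof. by exists (rrepr u); rewrite rreprK. Qed.

Lemma rmulA : associative rmul.
Proof.
move=> u v w; have [x ->] := rpiP u; have [y ->] := rpiP v.
by have [z ->] := rpiP w; rewrite -!rpiM mulrA.
Qed.

Lemma rmul1r : left_id (rpi 1) rmul.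
Proof. by move=> u; have [x ->] := rpiP u; rewrite -rpiM mul1r. Qed.

Lemma rmulr1 : right_id (rpi 1) rmul.
Proof. by move=> u; have [x ->] := rpiP u; rewrite -rpiM mulr1. Qed.

Lemma rmulDl : left_distributive rmul +%R.
Proof.
move=> u v w; have [x ->] := rpiP u; have [y ->] := rpiP v.
by have [z ->] := rpiP w; rewrite -rpiD -!rpiM -rpiD mulrDl.
Qed.

Lemma rmulDr : right_distributive rmul +%R.
Proof.
move=> u v w; have [x ->] := rpiP u; have [y ->] := rpiP v.
by have [z ->] := rpiP w; rewrite -rpiD -!rpiM -rpiD mulrDr.
Qed.

HB.instance Definition _ := GRing.Zmodule_isPzRing.Build ring_quot
  rmulA rmul1r rmulr1 rmulDl rmulDr.

HB.instance Definition _ := GRing.isZmodMorphism.Build R ring_quot rpi rpiB.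

Lemma rpi_monoid : monoid_morphism rpi.
Proof. by split=> // x y; rewrite rpiM. Qed.

HB.instance Definition _ := GRing.isMonoidMorphism.Build R ring_quot rpi
  rpi_monoid.

End RingQuot.

Section SubgroupType.
Variables (V : zmodType) (S : V -> Prop).

Definition subgroup_pred : V -> bool := fun x => `[< subgroup_gen S x >].

Lemma subgroup_pred_zmod : zmod_closed subgroup_pred.
Proof.
split=> [|x y /asboolP Ix /asboolP Iy]; apply/asboolP.
  exact: subgroup_gen0.
exact: subgroup_genB.
Qed.

HB.instance Definition _ := GRing.isZmodClosed.Build V subgroup_pred
  subgroup_pred_zmod.

Record subgroup_type : predArgType :=
  Subgroup { subgroup_val :> V; _ : subgroup_val \in subgroup_pred }.

HB.instance Definition _ := [isSub for subgroup_val].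
HB.instance Definition _ := [Choice of subgroup_type by <:].
HB.instance Definition _ := [SubChoice_isSubZmodule of subgroup_type by <:].

End SubgroupType.

Section ModTwo.
Variable V : zmodType.

Definition twice_pred : V -> bool := fun x => `[< exists y : V, x = y *+ 2 >].

Lemma twice_pred_zmod : zmod_closed twice_pred.
Proof.
split=> [|x y /asboolP[x' ->] /asboolP[y' ->]]; apply/asboolP.
  by exists 0; rewrite mul0rn.
by exists (x' - y'); rewrite mulrnBl.
Qed.

HB.instance Definition _ := GRing.isZmodClosed.Build V twice_pred
  twice_pred_zmod.
Definition twice_closed : zmodClosed V :=
  GRing.ZmodClosed.clone V twice_pred _.

Definition mod2 : Type := Quotient.quot twice_closed.
HB.instance Definition _ := GRing.Zmodule.on mod2.

Definition mod2_pi (x : V) : mod2 := \pi_(Quotient.quot twice_closed) x.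
Definition mod2_repr (u : mod2) : V := repr (u : Quotient.quot twice_closed).

Lemma mod2_reprK u : mod2_pi (mod2_repr u) = u. Proof. exact: reprK. Qed.

Lemma mod2_pi_eq x y : mod2_pi x = mod2_pi y <-> exists z, x - y = z *+ 2.
Proof.
split.
  by move/eqP; rewrite /mod2_pi -Quotient.idealrBE => /asboolP.
by move=> h; apply/eqP; rewrite /mod2_pi -Quotient.idealrBE; apply/asboolP.
Qed.

Lemma mod2_piB : {morph mod2_pi : x y / x - y}.
Proof. by move=> x y; rewrite /mod2_pi raddfB. Qed.

HB.instance Definition _ := GRing.isZmodMorphism.Build V mod2 mod2_pi mod2_piB.

End ModTwo.

(* The tensor algebra over the integers of an abelian group A, presented as   *)
(* the free associative ring on the set A modulo additivity of the generators *)
(* (so that A maps to it additively and universally).                         *)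
Definition free_ring (A : choiceType) := {malg int[{fmonom A}]}.
HB.instance Definition _ (A : choiceType) := GRing.NzRing.on (free_ring A).

Definition free_gen (A : choiceType) (a : A) : free_ring A := << fmu a >>.

Definition tensor_rel (A : zmodType) (x : free_ring A) : Prop :=
  exists a b : A, x = free_gen (a + b) - free_gen a - free_gen b.

Definition tensor_algebra (A : zmodType) : Type := ring_quot (@tensor_rel A).
HB.instance Definition _ (A : zmodType) := GRing.PzRing.on (tensor_algebra A).

Definition tensor_gen (A : zmodType) (a : A) : tensor_algebra A :=
  rpi (@tensor_rel A) (free_gen a).

Lemma tensor_genD (A : zmodType) : {morph @tensor_gen A : a b / a + b}.
Proof.
move=> a b; rewrite /tensor_gen -rpiD; apply/rpi_eq; apply: ideal_gen_in.
by exists a, b; rewrite opprD addrA.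
Qed.

(* The multiplicative group of F, as an abelian group in additive notation:  *)
(* the sum of two elements of Fx F is their product in F.                    *)
Section MultiplicativeGroup.
Variable F : fieldType.

Record Fx : predArgType := MkFx { Fx_val :> F; _ : Fx_val != 0 }.

HB.instance Definition _ := [isSub for Fx_val].
HB.instance Definition _ := [Choice of Fx by <:].

Lemma Fx_neq0 (a : Fx) : (a : F) != 0. Proof. exact: (valP a). Qed.

Definition Fx_one : Fx := MkFx (oner_neq0 F).
Definition Fx_mul (a b : Fx) : Fx := MkFx (mulf_neq0 (Fx_neq0 a) (Fx_neq0 b)).
Lemma Fx_inv_neq0 (a : Fx) : (a : F)^-1 != 0.
Proof. by rewrite invr_eq0 Fx_neq0. Qed.
Definition Fx_inv (a : Fx) : Fx := MkFx (Fx_inv_neq0 a).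

Lemma Fx_mulA : associative Fx_mul.
Proof. by move=> a b c; apply: val_inj; rewrite /= mulrA. Qed.
Lemma Fx_mulC : commutative Fx_mul.
Proof. by move=> a b; apply: val_inj; rewrite /= mulrC. Qed.
Lemma Fx_mul1 : left_id Fx_one Fx_mul.
Proof. by move=> a; apply: val_inj; rewrite /= mul1r. Qed.
Lemma Fx_mulV : left_inverse Fx_one Fx_inv Fx_mul.
Proof. by move=> a; apply: val_inj; rewrite /= mulVf ?Fx_neq0. Qed.

HB.instance Definition _ := GRing.isZmodule.Build Fx
  Fx_mulA Fx_mulC Fx_mul1 Fx_mulV.

Lemma Fx_m1_neq0 : (-1 : F) != 0. Proof. by rewrite oppr_eq0 oner_neq0. Qed.
Definition Fx_m1 : Fx := MkFx Fx_m1_neq0.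

End MultiplicativeGroup.

Section MilnorK.
Variable F : fieldType.

(* As a and b are both units, b = 1 - a forces a to be different from 0, 1. *)
Definition steinberg_rel (x : tensor_algebra (Fx F)) : Prop :=
  exists a b : Fx F, (b : F) = 1 - (a : F) /\ x = tensor_gen a * tensor_gen b.

Definition milnorK : Type := ring_quot steinberg_rel.
HB.instance Definition _ := GRing.PzRing.on milnorK.

Definition Kgen (a : Fx F) : milnorK := rpi steinberg_rel (tensor_gen a).

Definition Ksymb (s : seq (Fx F)) : milnorK := \prod_(a <- s) Kgen a.

(* The degree n part: in the tensor algebra, degree n is spanned by the      *)
(* products of n generators.                                                 *)
Definition is_symbol_elt (n : nat) (x : milnorK) : Prop :=
  exists a : n.-tuple (Fx F), x = Ksymb a.

Definition milnorKn (n : nat) : Type := subgroup_type (is_symbol_elt n).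
HB.instance Definition _ n := GRing.Zmodule.on (milnorKn n).

Lemma Ksymb_deg n (a : n.-tuple (Fx F)) :
  Ksymb a \in subgroup_pred (is_symbol_elt n).
Proof. by apply/asboolP; apply: subgroup_gen_in; exists a. Qed.

Definition Knsymb n (a : n.-tuple (Fx F)) : milnorKn n :=
  Subgroup (Ksymb_deg a).

Definition milnorK2 : Type := ring_quot (fun x : milnorK => x = 2%:R).
HB.instance Definition _ := GRing.PzRing.on milnorK2.

Definition milnorK2_pi : milnorK -> milnorK2 := @rpi milnorK (fun x => x = 2%:R).
HB.instance Definition _ := GRing.RMorphism.on milnorK2_pi.

Definition milnorKn2 (n : nat) : Type := mod2 (milnorKn n).
HB.instance Definition _ n := GRing.Zmodule.on (milnorKn2 n).

Definition is_symbol n (s : milnorKn2 n) : Prop :=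
  exists a : n.-tuple (Fx F), s = mod2_pi (Knsymb a).

(* The map from K_n / 2 to K_* / 2 induced by the inclusion of K_n in K_*.   *)
Definition Kn2_incl n (u : milnorKn2 n) : milnorK2 :=
  milnorK2_pi (subgroup_val (mod2_repr u)).

Lemma Kn2_inclE n (x : milnorKn n) :
  Kn2_incl (mod2_pi x) = milnorK2_pi (subgroup_val x).
Proof.
apply/rpi_eq; have /mod2_pi_eq[z Dz] := mod2_reprK (mod2_pi x).
have -> : subgroup_val (mod2_repr (mod2_pi x)) - subgroup_val x
        = subgroup_val z * 2%:R.
  rewrite mulr_natr; have := congr1 (@subgroup_val _ _) Dz.
  by rewrite -[LHS]/(\val _) raddfB -[RHS]/(\val _) raddfMn.
by apply/ideal_genMl/ideal_gen_in.
Qed.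

Lemma Kn2_inclB n : {morph @Kn2_incl n : u v / u - v}.
Proof.
move=> u v; rewrite -[u]mod2_reprK -[v]mod2_reprK -mod2_piB !Kn2_inclE.
by rewrite -raddfB.
Qed.

HB.instance Definition _ n := GRing.isZmodMorphism.Build
  (milnorKn2 n) milnorK2 (@Kn2_incl n) (@Kn2_inclB n).

Definition tau (i : nat) (x : milnorK2) : milnorK2 :=
  milnorK2_pi (Kgen (Fx_m1 F)) ^+ i.-1 * x.

End MilnorK.

(* Main.v *)
Require Import Defs.
From mathcomp Require Import all_boot all_order all_algebra.
From HB Require Import structures.
From mathcomp Require Import finmap monalg boolp.

Set Implicit Arguments.
Unset Strict Implicit.
Unset Printing Implicit Defensive.

Import GRing.Theory.
Local Open Scope ring_scope.

(** Divided powers are the coefficients of a total operation: the elementary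
    symmetric functions of s_1, ..., s_l are the coefficients of the product of
    the polynomials 1 + s_j X. So it suffices to show that s |-> 1 + s X extends
    from symbols to a homomorphism from K_i / 2 to a multiplicative group of
    polynomials; the map of the theorem is then y times the n-th coefficient.

    The ring K_* / 2 is commutative (Kgen_anticomm, milnorK2_mulC), and as the
    result is multiplied by y, coefficients may be taken in the quotient C of
    K_* / 2 by the annihilator of y (annihilator_quotient). By the universal
    property of K_i (milnorK_lift, milnorKn2_lift), three conditions remain.
    - Steinberg symbols go to 1: they vanish in K_* / 2.
    - Multilinearity in one slot: (1 + s X) (1 + t X) = 1 + (s + t) X for symbols
      s, t that differ only in that slot, that is s t = 0 in C. By {a, a} =
      {-1, a}, each of the i - 1 common entries contributes a factor {-1} to the
      product s t, and {-1}^(i-1) is 0 in C because tau_i kills y (gsymb_mul0).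
    - Doubles go to 1: (1 + s X)^2 = 1 as 2 = 0 and s^2 = 0, the last equation
      being the special case s = t of the previous one. Hence the group of
      elements of square 1 can serve as the target (total_symbol_lift).

    Uniqueness holds because every element of K_i / 2 is a sum of symbols. *)

(** * The free ring and maps out of a quotient ring *)

(** Spanning a group by differences, phrased as the induction principle by which
    it is used, so that it can serve as an eliminator. *)
Definition additively_spans (R : zmodType) (T : Type) (w : T -> R) : Prop :=
  forall P : R -> Prop, P 0 -> (forall x y, P x -> P y -> P (x - y)) ->
    (forall t, P (w t)) -> forall x, P x.

(** For a map out of a ring, vanishing on the two-sided ideal of x need only be
    tested on multiples of x by spanning elements. *)
Lemma spanning_vanish (R : pzRingType) (T : Type) (w : T -> R) (V : zmodType)
    (g : {additive R -> V}) (x : R) :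
    additively_spans w -> (forall s t, g (w s * x * w t) = 0) ->
  forall p q, g (p * x * q) = 0.
Proof.
move=> w_ind gw p q; elim/w_ind: p => [|p p' gp gp'|s].
- by rewrite !mul0r raddf0.
- by rewrite !mulrBl raddfB gp gp' subrr.
elim/w_ind: q => [|q q' gq gq'|t]; last exact: gw.
  by rewrite mulr0 raddf0.
by rewrite mulrBr raddfB gq gq' subrr.
Qed.

Section FreeRing.
Variable A : choiceType.
Implicit Types (x y : free_ring A) (s : seq A).

Definition free_word s : free_ring A := \prod_(a <- s) free_gen a.

Lemma free_wordE s : free_word s = << FMonom s >>.
Proof.
rewrite /free_word; elim: s => [|a s IHs].
  by rewrite big_nil -fmoneE.
rewrite big_cons IHs /free_gen; apply/malgP => k.
rewrite malgM_def fgmulUU mulr1.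
suff -> : mmul (fmu a) (FMonom s) = FMonom (a :: s) by [].
by rewrite -[LHS]fmK fmM fmuE.
Qed.

Lemma free_word_spans : additively_spans free_word.
Proof.
move=> P P0 PB Pw x.
have PN z : P z -> P (- z) by rewrite -sub0r; apply: PB.
have PD z t : P z -> P t -> P (z + t).
  by move=> Pz Pt; rewrite -[t]opprK; apply/PB/PN.
rewrite [x]monalgE; elim/big_ind: _ => // k _.
have Pn n : P (<< 1 *g k >> *+ n).
  elim: n => [|n IHn]; rewrite ?mulr0n // mulrS; apply: PD IHn.
  by have := Pw k; rewrite free_wordE fmK.
case: (x@_k) => n.
  by rewrite -[Posz n]natz monalgUMn.
by rewrite NegzE -[Posz _]natz monalgUN monalgUMn; apply: PN.
Qed.

Variables (V : zmodType) (phi : seq A -> V).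

Definition free_lin x : V := \sum_(k <- msupp x) phi k *~ x@_k.

Lemma free_linEw x (d : {fset {fmonom A}}) :
  (msupp x `<=` d)%fset -> free_lin x = \sum_(k <- d) phi k *~ x@_k.
Proof.
move=> le_xd; rewrite /free_lin (big_fset_incl _ le_xd) // => k _.
by move/mcoeff_outdom=> ->; rewrite mulr0z.
Qed.

Lemma free_linB : {morph free_lin : x y / x - y}.
Proof.
move=> x y; pose d := (msupp x `|` msupp y)%fset.
rewrite (@free_linEw x d) ?fsubsetUl // (@free_linEw y d) ?fsubsetUr //.
rewrite (@free_linEw _ d) ?msuppB_le // -sumrB.
by apply: eq_bigr => k _; rewrite mcoeffB mulrzBr.
Qed.

HB.instance Definition _ :=
  GRing.isZmodMorphism.Build (free_ring A) V free_lin free_linB.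

Lemma free_lin_word s : free_lin (free_word s) = phi s.
Proof.
by rewrite free_wordE /free_lin msuppU1 big_seq_fset1 mcoeffUU mulr1z.
Qed.

End FreeRing.

Lemma free_word_cat (A : choiceType) (s t : seq A) :
  free_word (s ++ t) = free_word s * free_word t.
Proof. exact: big_cat. Qed.

Lemma free_word1 (A : choiceType) (a : A) : free_word [:: a] = free_gen a.
Proof. exact: big_seq1. Qed.

Lemma rpi_ind (R : pzRingType) (S : R -> Prop) (P : ring_quot S -> Prop) :
  (forall x, P (rpi S x)) -> forall u, P u.
Proof. by move=> Px u; rewrite -[u]rreprK. Qed.

Lemma ring_quot_lift (R : pzRingType) (S : R -> Prop) (V : zmodType)
    (g : {additive R -> V}) :
    (forall x p q, S x -> g (p * x * q) = 0) ->
  exists h : {additive ring_quot S -> V}, forall x, h (rpi S x) = g x.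
Proof.
move=> gS.
have gI x : ideal_gen S x -> forall p q, g (p * x * q) = 0.
  elim=> {x} [x Sx|| x y _ gx _ gy | a x _ gx | a x _ gx] p q.
  - exact: gS.
  - by rewrite mulr0 mul0r raddf0.
  - by rewrite mulrBr mulrBl raddfB gx gy subrr.
  - by rewrite mulrA gx.
  - by rewrite mulrA -mulrA gx.
pose h (u : ring_quot S) := g (rrepr u).
have hE x : h (rpi S x) = g x.
  apply/eqP; rewrite -subr_eq0 -raddfB -[_ - _]mul1r -[_ * _]mulr1.
  by apply/eqP/gI/rpi_eq; rewrite rreprK.
have hB : zmod_morphism h.
  elim/rpi_ind=> x; elim/rpi_ind=> y.
  by rewrite -raddfB !hE raddfB.
pose hM := GRing.isZmodMorphism.Build _ _ h hB.
pose H : {additive ring_quot S -> V} := HB.pack h hM.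
by exists H.
Qed.

(** * Universal property of Milnor K-groups *)

Section MilnorWords.
Variable F : fieldType.

Lemma Ksymb_spans : additively_spans (@Ksymb F).
Proof.
move=> P P0 PB Pw; elim/rpi_ind; elim/rpi_ind; elim/free_word_spans.
- by rewrite !raddf0.
- by move=> x y Px Py; rewrite !raddfB; apply: PB.
- by move=> s; rewrite !rmorph_prod; apply: Pw.
Qed.

(** The presentation of K_i as the i-th tensor power of the group of units
    modulo Steinberg words, in its universal form. The grading is not proved
    beforehand: the lift is the linear extension to the free ring of the function
    that is phi on words of length i and 0 on all other words, and since each
    relation is homogeneous this extension kills both ideals. *)
Lemma milnorK_lift (i : nat) (V : zmodType) (phi : seq (Fx F) -> V) :
    (forall s t a b, size (s ++ a :: t) = i ->
       phi (s ++ (a + b) :: t) = phi (s ++ a :: t) + phi (s ++ b :: t)) ->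
    (forall s t (a b : Fx F), size (s ++ a :: b :: t) = i ->
       (b : F) = 1 - (a : F) -> phi (s ++ a :: b :: t) = 0) ->
  exists h : {additive milnorK F -> V},
    forall s, h (Ksymb s) = if size s == i then phi s else 0.
Proof.
move=> phiD phiS; pose psi s := if size s == i then phi s else 0.
have [|h1 h1E] := @ring_quot_lift _ (@tensor_rel (Fx F)) V (free_lin psi).
  move=> _ p q [a [b ->]].
  apply: (spanning_vanish (@free_word_spans (Fx F))) p q => s t.
  rewrite !(mulrBr, mulrBl) !raddfB /= -!free_word1 -!free_word_cat -!catA.
  rewrite !free_lin_word /psi !size_cat /=.
  by case: eqP => [i_eq | _]; rewrite ?subrr // phiD ?size_cat //
    addrAC addrK subrr.
have h1w s : h1 (\prod_(a <- s) tensor_gen a) = psi s.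
  by rewrite -free_lin_word -h1E rmorph_prod.
have [|h hE] := @ring_quot_lift _ (@steinberg_rel F) V h1.
  move=> _ p q [a [b [ab ->]]]; elim/rpi_ind: p => p; elim/rpi_ind: q => q.
  have -> : rpi _ p * (tensor_gen a * tensor_gen b) * rpi _ q
      = rpi (@tensor_rel _) (p * (free_gen a * free_gen b) * q).
    by rewrite !rmorphM.
  rewrite h1E; apply: (spanning_vanish (@free_word_spans (Fx F))) p q => s t.
  rewrite -!free_word1 -!free_word_cat /= free_lin_word -!catA /psi.
  by case: eqP => // /phiS->.
exists h => s; rewrite -[if _ then _ else _]/(psi s) -h1w -hE; congr (h _).
by rewrite rmorph_prod.
Qed.

End MilnorWords.

Lemma milnorKn2_lift (F : fieldType) (i : nat) (V : zmodType)
    (phi : seq (Fx F) -> V) :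
    (forall v : V, v *+ 2 = 0) ->
    (forall s t a b, size (s ++ a :: t) = i ->
       phi (s ++ (a + b) :: t) = phi (s ++ a :: t) + phi (s ++ b :: t)) ->
    (forall s t (a b : Fx F), size (s ++ a :: b :: t) = i ->
       (b : F) = 1 - (a : F) -> phi (s ++ a :: b :: t) = 0) ->
  exists h : {additive milnorKn2 F i -> V},
    forall a : i.-tuple (Fx F), h (mod2_pi (Knsymb a)) = phi a.
Proof.
move=> V2 phiD phiS; have [g gE] := milnorK_lift phiD phiS.
pose gi : {additive milnorKn F i -> V} :=
  g \o (\val : milnorKn F i -> milnorK F).
pose h (u : milnorKn2 F i) : V := gi (mod2_repr u).
have hE x : h (mod2_pi x) = gi x.
  have /mod2_pi_eq[z Dz] := mod2_reprK (mod2_pi x).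
  by apply/eqP; rewrite -subr_eq0 -raddfB Dz raddfMn; apply/eqP/V2.
have hB : zmod_morphism h.
  move=> u v; rewrite -[u]mod2_reprK -[v]mod2_reprK -raddfB !hE.
  exact: raddfB.
pose H : {additive milnorKn2 F i -> V} :=
  HB.pack h (GRing.isZmodMorphism.Build _ _ h hB).
by exists H => a; rewrite [LHS]hE /= gE size_tuple eqxx.
Qed.

(** No signs are needed, since s = - s modulo 2. *)
Lemma milnorKn2_sum_symbols (F : fieldType) (i : nat) (u : milnorKn2 F i) :
  exists (l : nat) (s : 'I_l -> milnorKn2 F i),
    (forall j, is_symbol (s j)) /\ u = \sum_(j < l) s j.
Proof.
have oppK2 (v : milnorKn2 F i) : - v = v.
  apply/esym/eqP; rewrite -addr_eq0 -[v]mod2_reprK -mulr2n -raddfMn.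
  rewrite -(raddf0 (@mod2_pi (milnorKn F i))); apply/eqP/mod2_pi_eq.
  by rewrite subr0; eexists.
pose span (v : milnorKn2 F i) := exists r : seq (milnorKn2 F i),
  (forall s, s \in r -> is_symbol s) /\ v = \sum_(s <- r) s.
suff [r [sym_r ->]] : span u.
  exists (size r), (tnth (in_tuple r)); split=> [j|]; last exact: big_tnth.
  exact/sym_r/mem_tnth.
rewrite -[u]mod2_reprK; case: (mod2_repr u) => x xP.
have Ix : subgroup_gen (@is_symbol_elt F i) x by apply/asboolP.
elim: Ix xP => {x} [x [a ->]|| x y Ix IHx Iy IHy] xP.
- exists [:: mod2_pi (Knsymb a)]; split; last first.
    by rewrite big_seq1; congr mod2_pi; apply: val_inj.
  by move=> s; rewrite inE => /eqP->; exists a.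
- exists [::]; split=> //; rewrite big_nil -[RHS](raddf0 (@mod2_pi _)).
  by congr mod2_pi; apply: val_inj.
have xS : x \in subgroup_pred (@is_symbol_elt F i) by apply/asboolP.
have yS : y \in subgroup_pred (@is_symbol_elt F i) by apply/asboolP.
have [r [sym_r rE]] := IHx xS; have [r' [sym_r' rE']] := IHy yS.
exists (r ++ r'); split=> [s|].
  by rewrite mem_cat => /orP[/sym_r | /sym_r'].
rewrite big_cat /= -rE -rE' -[mod2_pi (Subgroup yS)]oppK2 -raddfB.
by congr mod2_pi; apply: val_inj.
Qed.

(** * Relations in the Milnor ring and commutativity modulo 2 *)

Section MilnorRelations.
Variable F : fieldType.

Lemma Kgen0 : Kgen (0 : Fx F) = 0.
Proof.
rewrite /Kgen; suff -> : tensor_gen (0 : Fx F) = 0 by rewrite raddf0.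
by apply: (@addrI _ (tensor_gen 0)); rewrite -tensor_genD !addr0.
Qed.

Lemma KgenD (a b : Fx F) : Kgen (a + b) = Kgen a + Kgen b.
Proof. by rewrite /Kgen tensor_genD raddfD. Qed.

Lemma KgenN (a : Fx F) : Kgen (- a) = - Kgen a.
Proof. by apply/eqP; rewrite -addr_eq0 -KgenD addNr Kgen0. Qed.

Lemma Kgen_steinberg (a b : Fx F) :
  (b : F) = 1 - (a : F) -> Kgen a * Kgen b = 0.
Proof.
move=> ab; rewrite /Kgen -rmorphM -(raddf0 (rpi (@steinberg_rel F))).
by apply/rpi_eq; rewrite subr0; apply: ideal_gen_in; exists a, b.
Qed.

(** The relation {a, -a} = 0, the group of units being written additively: it
    holds because - a = (1 - a) / (1 - a^-1) for a different from 1. *)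
Lemma Kgen_opp (a : Fx F) : Kgen a * Kgen (a + Fx_m1 F) = 0.
Proof.
have [a1 | a_neq1] := eqVneq (a : F) 1.
  by have -> : a = 0; [apply: val_inj | rewrite Kgen0 mul0r].
have b_neq0 : 1 - (a : F) != 0 by rewrite subr_eq0 eq_sym.
have c_neq0 : 1 - (a : F)^-1 != 0 by rewrite subr_eq0 eq_sym invr_eq1.
pose b := MkFx b_neq0; pose c := MkFx c_neq0.
have -> : a + Fx_m1 F = b - c.
  apply: val_inj => /=; have a_neq0 := Fx_neq0 a.
  have ->: 1 - (a : F)^-1 = - (1 - (a : F)) / (a : F).
    by rewrite opprB mulrBl divff // mul1r.
  by rewrite invf_div invrN mulrCA !mulrN1 mulrN divff ?mulrN1.
rewrite KgenD KgenN mulrBr (@Kgen_steinberg a b) // sub0r -mulNr -KgenN.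
exact: Kgen_steinberg.
Qed.

Lemma Kgen_sqr (a : Fx F) : Kgen a * Kgen a = - (Kgen a * Kgen (Fx_m1 F)).
Proof. by apply/eqP; rewrite -addr_eq0 -mulrDr -KgenD Kgen_opp. Qed.

(** Polarization of {a, a} = - {a, -1}. *)
Lemma Kgen_anticomm (a b : Fx F) : Kgen a * Kgen b = - (Kgen b * Kgen a).
Proof.
have := Kgen_sqr (a + b); rewrite KgenD.
have := Kgen_sqr a; have := Kgen_sqr b.
move: (Kgen a) (Kgen b) (Kgen (Fx_m1 F)) => x y e yy xx.
rewrite !(mulrDl, mulrDr) xx yy opprD -addrA => /addrI.
by rewrite addrA -[RHS]add0r => /addIr/eqP; rewrite addr_eq0 => /eqP.
Qed.

Lemma milnorK2_char2 : 2%:R = 0 :> milnorK2 F.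
Proof.
rewrite -(rmorph_nat (@milnorK2_pi F)) -(raddf0 (@milnorK2_pi F)).
by apply/rpi_eq; rewrite subr0; apply: ideal_gen_in.
Qed.

Lemma milnorK2_oppr (x : milnorK2 F) : - x = x.
Proof.
by apply/esym/eqP; rewrite -addr_eq0 -mulr2n -mulr_natl milnorK2_char2 mul0r.
Qed.

Lemma milnorK2_piM : {morph @milnorK2_pi F : x y / x * y}.
Proof. exact: rmorphM. Qed.

Lemma milnorK2_piN (x : milnorK F) : milnorK2_pi (- x) = milnorK2_pi x.
Proof. by rewrite raddfN milnorK2_oppr. Qed.

Lemma Kgen2C (a b : Fx F) :
  milnorK2_pi (Kgen a) * milnorK2_pi (Kgen b)
  = milnorK2_pi (Kgen b) * milnorK2_pi (Kgen a).
Proof.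
rewrite -!milnorK2_piM.
exact: etrans (congr1 _ (Kgen_anticomm a b)) (milnorK2_piN _).
Qed.

Lemma Kgen2_sqr (a : Fx F) :
  milnorK2_pi (Kgen a) * milnorK2_pi (Kgen a)
  = milnorK2_pi (Kgen (Fx_m1 F)) * milnorK2_pi (Kgen a).
Proof.
rewrite [RHS]Kgen2C -!milnorK2_piM.
exact: etrans (congr1 _ (Kgen_sqr a)) (milnorK2_piN _).
Qed.

Lemma Kgen2_steinberg (a b : Fx F) : (b : F) = 1 - (a : F) ->
  milnorK2_pi (Kgen a) * milnorK2_pi (Kgen b) = 0.
Proof. by move=> ab; rewrite -milnorK2_piM (Kgen_steinberg ab) raddf0. Qed.

Lemma milnorK2_mulC : commutative (@GRing.mul (milnorK2 F)).
Proof.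
suff comm_pi (x y : milnorK F) : GRing.comm (milnorK2_pi x) (milnorK2_pi y).
  by elim/rpi_ind=> x; elim/rpi_ind=> y; apply: comm_pi.
have commS (z : milnorK2 F) : (forall a, GRing.comm z (milnorK2_pi (Kgen a))) ->
    forall x, GRing.comm z (milnorK2_pi x).
  move=> comm_gen; elim/Ksymb_spans=> [|t t' ct ct'|s].
  - by rewrite raddf0; apply: commr0.
  - have -> : milnorK2_pi (t - t') = milnorK2_pi t - milnorK2_pi t'.
      exact: raddfB.
    exact: (@commrB (milnorK2 F) _ _ _ ct ct').
  - by rewrite rmorph_prod; apply: commr_prod => a _; apply: comm_gen.
by apply: (commS) => a; apply/commr_sym/commS => b; apply: Kgen2C.
Qed.

End MilnorRelations.

(** * Elementary symmetric functions as coefficients *)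

(** Increasing n-tuples are the enumerations of the subsets with n elements. *)
Lemma sum_ltn_sorted_tuples (R : comPzRingType) (n l : nat) (a : 'I_l -> R) :
  \sum_(t : n.-tuple 'I_l | sorted ltn (map val t)) \prod_(j <- t) a j
  = \sum_(J : {set 'I_l} | #|J| == n) \prod_(j in J) a j.
Proof.
have uniq_sorted (t : seq 'I_l) : sorted ltn (map val t) -> uniq t.
  by move=> inc_t; rewrite -(map_inj_uniq val_inj) (sorted_uniq ltn_trans ltnn).
have inc_enum (J : {set 'I_l}) : sorted ltn (map val (enum J)).
  rewrite -[enum _](eq_filter (mem_enum _)).
  rewrite -(eq_filter (mem_map val_inj _)) -filter_map.
  by rewrite (sorted_filter ltn_trans) // unlock val_ord_enum iota_ltn_sorted.
pose f_t (t : n.-tuple 'I_l) := [set j in t].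
pose T := [set t : n.-tuple 'I_l | sorted ltn (map val t)].
have f_t_inj : {in T &, injective f_t}.
  move=> t t'; rewrite !inE => inc_t inc_t' /setP eq_tt'.
  apply/val_inj/(inj_map val_inj).
  apply: (irr_sorted_eq ltn_trans ltnn) => // y.
  apply/mapP/mapP=> -[j tj ->]; exists j => //; move: tj (eq_tt' j);
    by rewrite !inE => ->.
have f_tT : f_t @: T = [set J : {set 'I_l} | #|J| == n].
  apply/setP=> J; rewrite inE; apply/imsetP/idP => [[t]|cardJ].
    rewrite inE => inc_t ->.
    by rewrite cardsE (card_uniqP _) ?size_tuple // uniq_sorted.
  have sizeJ : size (enum J) == n by rewrite -cardE.
  exists (Tuple sizeJ); first by rewrite inE inc_enum.
  by apply/setP=> j; rewrite inE -[LHS]mem_enum.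
transitivity (\sum_(J in f_t @: T) \prod_(j in J) a j); last first.
  by apply: eq_bigl => J; rewrite f_tT inE.
rewrite (big_imset _ f_t_inj) /=; apply: eq_big => [t | t inc_t].
  by rewrite inE.
rewrite big_uniq ?uniq_sorted //.
by apply: eq_bigl => j; rewrite inE.
Qed.

Lemma coef_prod_1DZX (C : comNzRingType) (n l : nat) (a : 'I_l -> C) :
  (\prod_(j < l) (1 + a j *: 'X))`_n
  = \sum_(t : n.-tuple 'I_l | sorted ltn (map val t)) \prod_(j <- t) a j.
Proof.
rewrite sum_ltn_sorted_tuples.
under eq_bigr do rewrite addrC.
rewrite bigA_distr coef_sum [RHS]big_mkcond /=; apply: eq_bigr => J _.
rewrite -big_mkcond /= scaler_prodr coefZ coefXn eq_sym.
by case: eqP; rewrite ?mulr1 ?mulr0.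
Qed.

(** * Elements of square 1, and the quotient by an annihilator *)

Section InvolutiveUnits.
Variable B : comPzRingType.

(** The elements of square 1 form a group under multiplication. It is written
    additively here, so that a multiplicative invariant of symbols becomes an
    additive map, to which the universal property of K_i applies; being their own
    inverses, these elements are automatically killed by 2. *)
Record involution : predArgType :=
  Involution { inv_val :> B; _ : inv_val * inv_val == 1 }.

HB.instance Definition _ := [isSub for inv_val].
HB.instance Definition _ := [Choice of involution by <:].

Lemma inv_valK (u : involution) : inv_val u * inv_val u = 1.
Proof. exact/eqP/(valP u). Qed.

Fact inv_one_subproof : 1 * 1 == 1 :> B. Proof. by rewrite mulr1. Qed.
Definition inv_one := Involution inv_one_subproof.

Fact inv_mul_subproof (u v : involution) :
  inv_val u * inv_val v * (inv_val u * inv_val v) == 1.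
Proof. by rewrite mulrACA !inv_valK mulr1. Qed.
Definition inv_mul u v := Involution (inv_mul_subproof u v).

Lemma inv_mulA : associative inv_mul.
Proof. by move=> u v w; apply: val_inj; rewrite /= mulrA. Qed.
Lemma inv_mulC : commutative inv_mul.
Proof. by move=> u v; apply: val_inj; rewrite /= mulrC. Qed.
Lemma inv_mul1 : left_id inv_one inv_mul.
Proof. by move=> u; apply: val_inj; rewrite /= mul1r. Qed.
Lemma inv_mulV : left_inverse inv_one id inv_mul.
Proof. by move=> u; apply: val_inj; rewrite /= inv_valK. Qed.

HB.instance Definition _ := GRing.isZmodule.Build involution
  inv_mulA inv_mulC inv_mul1 inv_mulV.

Lemma inv_val_sum (I : Type) (r : seq I) (P : pred I) (u : I -> involution) :
  inv_val (\sum_(j <- r | P j) u j) = \prod_(j <- r | P j) inv_val (u j).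
Proof. by apply: (big_morph inv_val). Qed.

Lemma inv_mulr2n (u : involution) : u *+ 2 = 0.
Proof. by apply: val_inj; rewrite mulr2n; apply: inv_valK. Qed.

End InvolutiveUnits.

(** Dividing R by the annihilator of y turns identities that hold after
    multiplication by y into plain identities in a nonzero ring C, and
    multiplication by y, which factors through C, brings them back to R. *)
Lemma annihilator_quotient (R : pzRingType) (y : R) :
    commutative (@GRing.mul R) -> y <> 0 ->
  exists (C : comNzRingType) (pr : {rmorphism R -> C}) (mul_y : C -> R),
    (forall x, y * x = 0 -> pr x = 0) /\ (forall x, mul_y (pr x) = y * x).
Proof.
move=> mulC y_neq0; pose S x := y * x = 0.
have annI x : ideal_gen S x -> y * x = 0.
  elim=> {x} [x Sx|| x x' _ yx _ yx' | a x _ yx | a x _ yx] //.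
  - exact: mulr0.
  - by rewrite mulrBr yx yx' subrr.
  - by rewrite mulrA (mulC y) -mulrA yx mulr0.
  - by rewrite mulrA yx mul0r.
have QmulC : commutative (@GRing.mul (ring_quot S)).
  by elim/rpi_ind=> x; elim/rpi_ind=> x'; rewrite -!rmorphM mulC.
have Q1_neq0 : (1 : ring_quot S) != 0.
  apply/eqP; rewrite -(raddf0 (rpi S)) -(rmorph1 (rpi S)) => /rpi_eq/annI.
  by rewrite subr0 mulr1.
pose C : comNzRingType := HB.pack (ring_quot S)
  (GRing.PzSemiRing_hasCommutativeMul.Build (ring_quot S) QmulC)
  (GRing.PzSemiRing_isNonZero.Build (ring_quot S) Q1_neq0).
exists C, (rpi S : {rmorphism R -> C}), (fun u => y * rrepr u); split=> x.
  by move=> yx; rewrite -(raddf0 (rpi S)); apply/rpi_eq/ideal_gen_in; rewrite subr0.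
apply/eqP; rewrite -subr_eq0 -mulrBr; apply/eqP/annI/rpi_eq.
exact: rreprK.
Qed.

(** * The total operation on symbols *)

Lemma mul_1DZX (C : comNzRingType) (x z : C) :
  x * z = 0 -> (1 + x *: 'X) * (1 + z *: 'X) = 1 + (x + z) *: 'X :> {poly C}.
Proof.
move=> xz; rewrite mulrDl mul1r mulrDr mulr1 -scalerAl -scalerAr scalerA xz.
by rewrite scale0r addr0 scalerDl addrAC addrA.
Qed.

Section SymbolMonomials.
Variables (F : fieldType) (C : comNzRingType) (g : Fx F -> C).
Hypothesis gD : {morph g : a b / a + b}.
Hypothesis g_steinberg :
  forall a b : Fx F, (b : F) = 1 - (a : F) -> g a * g b = 0.
Hypothesis g_sqr : forall a, g a * g a = g (Fx_m1 F) * g a.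
Hypothesis char2 : 2%:R = 0 :> C.
Let eps := g (Fx_m1 F).

Definition gsymb (s : seq (Fx F)) : C := \prod_(a <- s) g a.

Lemma gsymb_sqr s : gsymb s * gsymb s = eps ^+ size s * gsymb s.
Proof.
rewrite /gsymb; elim: s => [|a s IHs] /=; first by rewrite big_nil.
by rewrite big_cons mulrACA IHs g_sqr exprS mulrACA.
Qed.

Lemma gsymb_split s a t : gsymb (s ++ a :: t) = gsymb (s ++ t) * g a.
Proof. by rewrite /gsymb !big_cat big_cons /= mulrCA mulrC. Qed.

Variable i : nat.
Hypothesis i_gt0 : (0 < i)%N.
Hypothesis eps_nil : eps ^+ i.-1 = 0.

(** The key cancellation: two symbols of length i that differ in one slot only
    share i - 1 entries, and squaring each shared entry yields a factor eps. *)
Lemma gsymb_mul0 s a b t : size (s ++ a :: t) = i ->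
  gsymb (s ++ a :: t) * gsymb (s ++ b :: t) = 0.
Proof.
rewrite size_cat addnS -size_cat => sz.
by rewrite !gsymb_split mulrACA gsymb_sqr -[size _]/(_.+1.-1) sz eps_nil !mul0r.
Qed.

Lemma gsymb_sqr0 s : size s = i -> gsymb s * gsymb s = 0.
Proof.
case: s => [sz|a s]; first by move: i_gt0; rewrite -sz.
exact: (@gsymb_mul0 [::]).
Qed.

(** The default value 0, the polynomial 1, is taken only on words of length other
    than i. *)
Definition symb_factor s : involution {poly C} :=
  insubd (0 : involution {poly C}) (1 + gsymb s *: 'X).

Lemma symb_factorE s : size s = i ->
  inv_val (symb_factor s) = 1 + gsymb s *: 'X.
Proof.
move=> sz; rewrite [LHS]insubdK // -topredE /=.
rewrite (mul_1DZX (gsymb_sqr0 sz)) -mulr2n -mulr_natl char2 mul0r.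
by rewrite scale0r addr0.
Qed.

(** Multilinearity of the factors 1 + s X is exactly the vanishing of the
    quadratic term, which is gsymb_mul0. *)
Lemma total_symbol_lift :
  exists h : {additive milnorKn2 F i -> involution {poly C}},
    forall a : i.-tuple (Fx F),
      inv_val (h (mod2_pi (Knsymb a))) = 1 + gsymb a *: 'X.
Proof.
have [|s t a b sz|s t a b sz ab|h hE] := @milnorKn2_lift F i _ symb_factor.
- exact: inv_mulr2n.
- have sz_c c : size (s ++ c :: t) = i by rewrite -sz !size_cat.
  apply: val_inj; rewrite /= !symb_factorE // mul_1DZX ?gsymb_mul0 //.
  by rewrite !gsymb_split gD mulrDr.
- apply: val_inj; rewrite /= symb_factorE // !gsymb_split -mulrA [g b * _]mulrC.
  by rewrite g_steinberg // mulr0 scale0r addr0.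
by exists h => a; rewrite hE symb_factorE ?size_tuple.
Qed.

End SymbolMonomials.

(** * Divided powers *)

Theorem proposition2p9 (n i : nat) (hn : (2 <= n)%N) (hi : (1 <= i)%N)
  (F : fieldType) (y : milnorK2 F) (hy : tau i y = 0) :
  exists! f : milnorKn2 F i -> milnorK2 F,
    forall (l : nat) (s : 'I_l -> milnorKn2 F i),
      (forall j, is_symbol (s j)) ->
      f (\sum_(j < l) s j) =
      y * \sum_(t : n.-tuple 'I_l | sorted ltn (map val t))
            \prod_(j <- t) Kn2_incl (s j).
Proof.
suff [f fE] : exists f : milnorKn2 F i -> milnorK2 F,
    forall (l : nat) (s : 'I_l -> milnorKn2 F i),
      (forall j, is_symbol (s j)) ->
      f (\sum_(j < l) s j) =
      y * \sum_(t : n.-tuple 'I_l | sorted ltn (map val t))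
            \prod_(j <- t) Kn2_incl (s j).
  exists f; split=> // f' f'E; apply/funext=> u.
  have [l [s [sym_s ->]]] := milnorKn2_sum_symbols u.
  by rewrite fE // f'E.
(* For y = 0 the quotient by the annihilator of y would be the zero ring. *)
have [-> | y_neq0] := pselect (y = 0).
  by exists (fun=> 0) => l s _; rewrite mul0r.
have [C [pr [mul_y [prI mul_yE]]]] :=
  annihilator_quotient (@milnorK2_mulC F) y_neq0.
pose g (a : Fx F) : C := pr (milnorK2_pi (Kgen a)).
have gD : {morph g : a b / a + b}.
  by move=> a b; rewrite /g KgenD !raddfD.
have gS (a b : Fx F) : (b : F) = 1 - (a : F) -> g a * g b = 0.
  by move=> ab; rewrite /g -[LHS]rmorphM (Kgen2_steinberg ab) raddf0.
have g_sqr a : g a * g a = g (Fx_m1 F) * g a.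
  rewrite /g -[LHS]rmorphM -[RHS]rmorphM.
  exact: congr1 (Kgen2_sqr a).
have char2 : 2%:R = 0 :> C by rewrite -(rmorph_nat pr) milnorK2_char2 raddf0.
have eps_nil : g (Fx_m1 F) ^+ i.-1 = 0.
  by rewrite /g -(rmorphXn pr); apply: prI; rewrite milnorK2_mulC.
have [h hE] := total_symbol_lift gD gS g_sqr char2 hi eps_nil.
have prE (a : i.-tuple (Fx F)) : gsymb g a = pr (Kn2_incl (mod2_pi (Knsymb a))).
  by rewrite Kn2_inclE /= /gsymb !rmorph_prod.
exists (fun u => mul_y (inv_val (h u))`_n) => l s sym_s.
have hsE j : inv_val (h (s j)) = 1 + pr (Kn2_incl (s j)) *: 'X.
  by have [a ->] := sym_s j; rewrite hE prE.
rewrite raddf_sum inv_val_sum (eq_bigr _ (fun j _ => hsE j)) coef_prod_1DZX.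
rewrite -mul_yE raddf_sum; congr mul_y; apply: eq_bigr => t _.
exact/esym/rmorph_prod.
Qed.
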